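(* Let $K$ be a field, let $\Delta$ be a simplicial complex on the vertex set $[n]$, and let $C$ be a vertex cover of $G_\Delta$. The ideal $P_C=(x_Ft : F\in\Delta_C)$ of $R_\Delta$ is a minimal prime ideal of $(t)$ in $R_\Delta$ if and only if $C$ is a minimal vertex cover of $G_\Delta$.
   Context: $[n]=\{1,\ldots,n\}$. A simplicial complex $\Delta$ on $[n]$ is a family of subsets of $[n]$ closed under taking subsets and containing all $\{i\}$, $i\in[n]$. For $F\subseteq [n]$ put $x_F=\prod_{i\in F}x_i$ (with $x_\emptyset=1$). The toric ring of $\Delta$ is the subalgebra $R_\Delta=K[x_Ft : F\in\Delta]$ of the polynomial ring $K[x_1,\ldots,x_n,t]$; here $t\in R_\Delta$ is the generator corresponding to the empty face. $G_\Delta$ is the graph (1-skeleton) on $[n]$ whose edges are the two-element faces of $\Delta$. A vertex cover of a graph is a set of vertices meeting every edge; it is minimal if it is minimal with respect to inclusion. For $W\subseteq[n]$, $\Delta_W=\{F\in\Delta : F\subseteq W\}$. *)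

(* Defs.v *)
From HB Require Import structures.
From mathcomp Require Import all_boot all_order all_algebra.
From mathcomp Require Import boolp.
From mathcomp Require Import mpoly.

Set Implicit Arguments.
Unset Strict Implicit.
Unset Printing Implicit Defensive.

Import GRing.Theory.
Local Open Scope ring_scope.

(* The vertex set [n] = {1, ..., n} is encoded as 'I_n = {0, ..., n-1}.
   [face0] follows from the two other axioms as soon as n > 0; for n = 0 it
   only excludes the void family, for which t would not lie in R_Delta. *)
Record simplicial_complex (n : nat) := SimplicialComplex {
  faces :> {set {set 'I_n}};
  face0 : set0 \in faces;
  face1 : forall i : 'I_n, [set i] \in faces;
  face_sub : forall F G : {set 'I_n}, F \in faces -> G \subset F -> G \in faces
}.

Section Covers.
Variables (n : nat) (D : simplicial_complex n).

Definition restriction (W : {set 'I_n}) : {set {set 'I_n}} :=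
  [set F in faces D | F \subset W].

(* The graph G_Delta is given by its set of edges. *)
Definition skeleton_edges : {set {set 'I_n}} := [set F in faces D | #|F| == 2%N].

End Covers.

Definition vertex_cover (T : finType) (E : {set {set T}}) (C : {set T}) : bool :=
  [forall e in E, C :&: e != set0].

Definition minimal_vertex_cover (T : finType) (E : {set {set T}}) (C : {set T})
  : bool := minset (vertex_cover E) C.

Section GeneratedSubalgebra.
Variables (K : pzRingType) (A : lalgType K) (s : seq A).

Definition subalg_gen : {pred A} :=
  fun p => `[< forall S : {pred A}, subalg_closed S -> {subset s <= S} -> p \in S >].

Lemma mem_subalg_gen : {subset s <= subalg_gen}.
Proof. by move=> p sp; apply/asboolP => S _; apply. Qed.

Lemma subalg_gen_closed : subalg_closed subalg_gen.
Proof.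
split.
- by apply/asboolP => S [].
- move=> a u v /asboolP hu /asboolP hv; apply/asboolP => S hS sS.
  by case: (hS) => _ lS _; apply: lS; [apply: hu | apply: hv].
- move=> u v /asboolP hu /asboolP hv; apply/asboolP => S hS sS.
  by case: (hS) => _ _ mS; apply: mS; [apply: hu | apply: hv].
Qed.

HB.instance Definition _ := GRing.isSubalgClosed.Build K A subalg_gen
  (GRing.subalg_closed_semi subalg_gen_closed).

End GeneratedSubalgebra.

Section ToricRing.
Variables (K : fieldType) (n : nat) (D : simplicial_complex n).

(* K[x_1, ..., x_n, t] is {mpoly K[n.+1]}, where t is the last variable. *)
Definition x_var (i : 'I_n) : {mpoly K[n.+1]} := 'X_(lift ord_max i).
Definition t_var : {mpoly K[n.+1]} := 'X_ord_max.
Definition face_monomial (F : {set 'I_n}) : {mpoly K[n.+1]} :=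
  (\prod_(i in F) x_var i) * t_var.

Definition toric_pred : {pred {mpoly K[n.+1]}} :=
  subalg_gen [seq face_monomial F | F in faces D].

HB.instance Definition _ := GRing.SubalgClosed.on toric_pred.

Record toric_ring := ToricRing {
  toric_val :> {mpoly K[n.+1]};
  toric_valP : toric_val \in toric_pred
}.

HB.instance Definition _ := [isSub for toric_val].
HB.instance Definition _ := [Choice of toric_ring by <:].
HB.instance Definition _ := [SubChoice_isSubComNzRing of toric_ring by <:].
HB.instance Definition _ := [SubZmodule_isSubLmodule of toric_ring by <:].
HB.instance Definition _ :=
  [SubNzRing_SubLmodule_isSubLalgebra of toric_ring by <:].
HB.instance Definition _ := [SubLalgebra_isSubAlgebra of toric_ring by <:].

Lemma face_monomial_toric (F : {set 'I_n}) :
  F \in faces D -> face_monomial F \in toric_pred.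
Proof. by move=> FD; apply: mem_subalg_gen; apply: image_f. Qed.

Definition toric_gen (F : {F : {set 'I_n} | F \in faces D}) : toric_ring :=
  ToricRing (face_monomial_toric (valP F)).

Definition toric_t : toric_ring := toric_gen (exist _ set0 (face0 D)).

Lemma toric_tE : toric_val toric_t = t_var.
Proof. by rewrite /= /face_monomial big_set0 mul1r. Qed.

End ToricRing.

Section Ideals.
Variable R : comNzRingType.

Definition ideal_gen (s : seq R) : {pred R} :=
  fun p => `[< exists c : 'I_(size s) -> R, p = \sum_(i < size s) c i * s`_i >].

(* [idealr_closed] includes properness. *)
Definition is_prime_ideal (P : {pred R}) : Prop :=
  idealr_closed P /\ prime_idealr_closed P.

Definition minimal_prime_over (I P : {pred R}) : Prop :=
  [/\ is_prime_ideal P, {subset I <= P} &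
      forall Q : {pred R}, is_prime_ideal Q -> {subset I <= Q} ->
        {subset Q <= P} -> Q =i P].

End Ideals.

Section CoverIdeal.
Variables (K : fieldType) (n : nat) (D : simplicial_complex n).

Definition cover_ideal (C : {set 'I_n}) : {pred toric_ring K D} :=
  ideal_gen [seq toric_gen K F |
    F <- enum {: {F : {set 'I_n} | F \in faces D}} & val F \in restriction D C].

End CoverIdeal.

Arguments cover_ideal K {n} D C _.

(* Main.v *)
Require Import Defs.
From mathcomp Require Import all_boot all_order all_algebra.
From mathcomp Require Import boolp mpoly.
From mathcomp Require Import zify ring.

(** Give [t] weight 1, a variable [x_i] weight 0 if [i] lies in the vertex cover
    [C] and weight -1 otherwise.  The complement of [C] is independent in the
    skeleton, so a face has at most one vertex outside [C]: the generator
    [x_F t] has weight 1 if [F] lies in [C] and weight 0 otherwise.  Hence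
    every element of the toric ring is the sum of an element of [P_C] and of
    an element of weight zero ([toric_decomposition]), whereas elements of [P_C]
    only involve monomials of positive weight ([cover_ideal_weight]).  The two
    parts meet in 0 only, and the weight-zero polynomials form a subring of a
    domain; so [P_C] is prime ([cover_ideal_prime]).

    If [C'] is a cover strictly inside [C], then [P_C'] is a prime ideal over
    [t] strictly inside [P_C].  Conversely let [C] be a minimal cover and let
    the prime [Q] satisfy [t \in Q] and [Q] inside [P_C].  Every vertex [i] of
    [C] has a neighbour [j] outside [C], and then
      [x_F t * x_j t = x_{i,j} t * x_{F minus i} t] for [F] containing [i].
    As [x_j t] has weight zero, it is not in [Q]; so [x_F t \in Q] follows
    from [x_{F minus i} t \in Q], and an induction that starts at
    [x_emptyset t = t] puts all generators of [P_C] in [Q]. *)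

Set Implicit Arguments.
Unset Strict Implicit.
Unset Printing Implicit Defensive.

Import GRing.Theory.
Local Open Scope ring_scope.

(** * Ideals *)

Section IdealGen.
Variable R : comNzRingType.
Implicit Types (s : seq R) (S : {pred R}).

Lemma ideal_gen0 s : 0 \in ideal_gen s.
Proof.
apply/asboolP; exists (fun=> 0).
by rewrite big1 // => i _; rewrite mul0r.
Qed.

Lemma ideal_gen_linear s a u v :
  u \in ideal_gen s -> v \in ideal_gen s -> a * u + v \in ideal_gen s.
Proof.
move=> /asboolP[c ->] /asboolP[d ->]; apply/asboolP.
exists (fun i => a * c i + d i).
rewrite mulr_sumr -big_split; apply: eq_bigr => i _ /=.
by rewrite mulrDl mulrA.
Qed.

Lemma ideal_genM s a u : u \in ideal_gen s -> a * u \in ideal_gen s.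
Proof. by move=> us; rewrite -[_ * _]addr0 ideal_gen_linear // ideal_gen0. Qed.

Lemma mem_ideal_gen s : {subset s <= ideal_gen s}.
Proof.
move=> x xs; apply/asboolP.
have lt_xs : (index x s < size s)%N by rewrite index_mem.
exists (fun i => (i == Ordinal lt_xs)%:R).
rewrite (bigD1 (Ordinal lt_xs)) //= eqxx mul1r nth_index // big1 ?addr0 //.
by move=> i /negPf->; rewrite mul0r.
Qed.

(** The form of the hypotheses on [S] is the one found in [idealr_closed],
    without properness, so that [S] may be an arbitrary ideal. *)
Lemma ideal_gen_sub s S : 0 \in S ->
    (forall a, {in S &, forall u v, a * u + v \in S}) ->
  {subset s <= S} -> {subset ideal_gen s <= S}.
Proof.
move=> S0 SL sS p /asboolP[c ->].
elim/big_rec: _ => // i v _; apply: SL.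
by apply: sS; rewrite mem_nth.
Qed.

End IdealGen.

(** * Weights of monomials *)

Section Weights.
Variables (K : nzRingType) (n : nat) (a : 'I_n -> int).
Implicit Types (p q : {mpoly K[n]}) (P : pred int).

(** The weights are integers because the variables outside the vertex cover
    will get weight -1. *)
Definition mweight (m : 'X_{1..n}) : int := \sum_i a i *+ m i.

Definition supp_weight P : {pred {mpoly K[n]}} :=
  fun p => all (fun m => P (mweight m)) (msupp p).

Lemma mweight0 : mweight 0%MM = 0.
Proof. by rewrite /mweight big1 // => i _; rewrite mnmE mulr0n. Qed.

Lemma mweightD m1 m2 : mweight (m1 + m2)%MM = mweight m1 + mweight m2.
Proof.
rewrite /mweight -big_split; apply: eq_bigr => i _ /=.
by rewrite mnmDE mulrnDr.
Qed.

Lemma mweightU i : mweight U_(i)%MM = a i.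
Proof.
rewrite /mweight (bigD1 i) //= mnm1E eqxx mulr1n big1 ?addr0 // => j ji.
by rewrite mnm1E eq_sym (negPf ji) mulr0n.
Qed.

Lemma supp_weight0 P : 0 \in supp_weight P.
Proof. by rewrite unfold_in msupp0. Qed.

Lemma supp_weightX i : 'X_i \in supp_weight (pred1 (a i)).
Proof. by rewrite unfold_in msuppX /= mweightU eqxx. Qed.

Lemma supp_weight1 : 1 \in supp_weight (pred1 0).
Proof. by rewrite unfold_in msupp1 /= mweight0 eqxx. Qed.

Lemma supp_weight_linear P c p q :
  p \in supp_weight P -> q \in supp_weight P -> c *: p + q \in supp_weight P.
Proof.
move=> /allP hp /allP hq; apply/allP => m /msuppD_le.
by rewrite mem_cat => /orP[/msuppZ_le/hp | /hq].
Qed.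

Lemma supp_weightD P p q :
  p \in supp_weight P -> q \in supp_weight P -> p + q \in supp_weight P.
Proof. by rewrite -{2}[p]scale1r; apply: supp_weight_linear. Qed.

Lemma supp_weightM P1 P2 P3 p q :
    (forall k l, P1 k -> P2 l -> P3 (k + l)) ->
  p \in supp_weight P1 -> q \in supp_weight P2 -> p * q \in supp_weight P3.
Proof.
move=> h /allP hp /allP hq; apply/allP => m /msuppM_le.
by case/allpairsP=> -[m1 m2] [/hp w1 /hq w2 ->]; rewrite mweightD h.
Qed.

Lemma supp_weight_sub P1 P2 p :
  subpred P1 P2 -> p \in supp_weight P1 -> p \in supp_weight P2.
Proof. by move=> h; apply: sub_all => m; apply: h. Qed.

Lemma supp_weight_prod (I : finType) (A : {set I}) (f : I -> {mpoly K[n]})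
    (k : I -> int) :
    (forall i, f i \in supp_weight (pred1 (k i))) ->
  \prod_(i in A) f i \in supp_weight (pred1 (\sum_(i in A) k i)).
Proof.
move=> hf; elim/big_rec2: _ => [|i x y _ hy]; first exact: supp_weight1.
by apply: supp_weightM (hf i) hy => ? ? /eqP-> /eqP->; apply/eqP.
Qed.

Lemma supp_weight_disjoint P1 P2 p :
    (forall k, P1 k -> ~~ P2 k) ->
  p \in supp_weight P1 -> p \in supp_weight P2 -> p = 0.
Proof.
move=> h /allP p1 /allP p2; apply/eqP; rewrite -msupp_eq0.
case: (msupp p) p1 p2 => // m s p1 p2; have mE := mem_head m s.
by have := h _ (p1 m mE); rewrite p2.
Qed.

End Weights.

(** * The cover ideal is prime *)

Section CoverIdealTheory.
Variables (K : fieldType) (n : nat) (D : simplicial_complex n).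
Implicit Types (C F : {set 'I_n}) (p u z : toric_ring K D).

(** The linear form on exponent vectors that exposes a face of the cone of
    the toric ring: it is nonnegative on all generators, and [P_C] is spanned by
    the monomials of the ring where it is positive. *)
Definition cover_weight C (j : 'I_n.+1) : int :=
  if unlift ord_max j is Some i then - (i \notin C)%:Z else 1.

Lemma face_monomial_neq0 F : face_monomial K F != 0.
Proof.
have X_neq0 i : 'X_i != 0 :> {mpoly K[n.+1]} by rewrite -msupp_eq0 msuppX.
apply: mulf_neq0; last exact: X_neq0.
by apply/prodf_neq0 => i _; apply: X_neq0.
Qed.

Lemma face_monomial_weight C F :
  face_monomial K F \in
    supp_weight (cover_weight C) (pred1 (1 - #|F :\: C|%:Z)).
Proof.
pose k i : int := - (i \notin C)%:Z.
have hx i : x_var K i \in supp_weight (cover_weight C) (pred1 (k i)).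
  by have := supp_weightX K (cover_weight C) (lift ord_max i);
    rewrite {2}/cover_weight liftK.
have ht : t_var K n \in supp_weight (cover_weight C) (pred1 1).
  by have := supp_weightX K (cover_weight C) ord_max;
    rewrite {2}/cover_weight unlift_none.
have -> : 1 - #|F :\: C|%:Z = \sum_(i in F) k i + 1.
  rewrite addrC sumrN; congr (- _ + _).
  rewrite -(big_morph Posz PoszD (erefl _)) -sum1_card; congr Posz.
  rewrite [in RHS]big_mkcond [in LHS]big_mkcond /=; apply: eq_bigr => i _.
  by rewrite inE andbC; case: (i \in F); case: (i \in C).
apply: supp_weightM (supp_weight_prod _ hx) ht => ? ? /eqP-> /eqP->.
exact/eqP.
Qed.

(** Two vertices of [F] outside [C] would form an edge that [C] misses. *)
Lemma face_outside_cover C F :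
  vertex_cover (skeleton_edges D) C -> F \in faces D -> (#|F :\: C| <= 1)%N.
Proof.
move=> hC FD; rewrite leqNgt; apply/negP.
case/card_gt1P=> i [j [/setDP[iF iC] /setDP[jF jC] ij]].
have ijD : [set i; j] \in faces D.
  by apply: face_sub FD _; rewrite subUset !sub1set iF.
have /forall_inP/(_ [set i; j]) := hC.
rewrite inE ijD cards2 ij => /(_ isT)/set0Pn[x].
by rewrite !inE => /andP[xC /orP[] /eqP xE]; move: iC jC; rewrite -xE xC.
Qed.

Lemma mem_cover_ideal_gen C (F : {F | F \in faces D}) :
  val F \subset C -> toric_gen K F \in cover_ideal K D C.
Proof.
move=> FC; apply: mem_ideal_gen; apply/mapP; exists F => //.
by rewrite mem_filter mem_enum inE (valP F) FC.
Qed.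

Lemma cover_ideal_sub C (S : {pred toric_ring K D}) : 0 \in S ->
    (forall a, {in S &, forall u v, a * u + v \in S}) ->
    (forall F : {F | F \in faces D}, val F \subset C -> toric_gen K F \in S) ->
  {subset cover_ideal K D C <= S}.
Proof.
move=> S0 SL hS; apply: ideal_gen_sub => // _ /mapP[F + ->].
by rewrite mem_filter inE => /andP[/andP[_ FC] _]; apply: hS.
Qed.

Lemma toric_t_cover C : toric_t K D \in cover_ideal K D C.
Proof. by apply: mem_cover_ideal_gen; rewrite /= sub0set. Qed.

Section Cover.
Variables (C : {set 'I_n}) (hC : vertex_cover (skeleton_edges D) C).

Local Notation wt P := (supp_weight (cover_weight C) P).
Local Notation nonneg := (fun k : int => 0 <= k).
Local Notation pos := (fun k : int => 0 < k).

Lemma toric_weight p : toric_val p \in wt nonneg.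
Proof.
case: p => p /= /asboolP; apply.
  split=> [|c u v|u v].
  - by apply: supp_weight_sub (supp_weight1 _ _) => _ /eqP->.
  - exact: supp_weight_linear.
  - by apply: supp_weightM => k l; lia.
move=> _ /imageP[F FD ->].
apply: supp_weight_sub (face_monomial_weight C F) => _ /eqP->.
by have := face_outside_cover hC FD; lia.
Qed.

Lemma cover_ideal_weight u : u \in cover_ideal K D C -> toric_val u \in wt pos.
Proof.
move: u; apply: (@cover_ideal_sub _ (fun u => toric_val u \in wt pos)).
- exact: supp_weight0.
- move=> a u v hu hv; apply: supp_weightD => //.
  by apply: supp_weightM (toric_weight a) hu => k l; lia.
- move=> F FC.
  apply: supp_weight_sub (face_monomial_weight C (val F)) => _ /eqP->.
  by move: FC; rewrite -setD_eq0 => /eqP->; rewrite cards0.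
Qed.

Lemma weight0_cover_ideal z :
  toric_val z \in wt (pred1 0) -> z \in cover_ideal K D C -> z = 0.
Proof.
move=> z0 /cover_ideal_weight zpos; apply: val_inj.
by apply: supp_weight_disjoint z0 zpos => k /eqP->.
Qed.

(** The sums [u + z] form a subalgebra, because [P_C] is an ideal and weight
    zero is stable under products; and each generator of the ring lies either in
    [P_C] or in weight zero, according to whether its face lies in [C]. *)
Lemma toric_decomposition p : exists u z,
  [/\ p = u + z, u \in cover_ideal K D C & toric_val z \in wt (pred1 0)].
Proof.
pose S : {pred {mpoly K[n.+1]}} := fun f => `[< exists u z : toric_ring K D,
  [/\ f = toric_val (u + z), u \in cover_ideal K D C
    & toric_val z \in wt (pred1 0)] >].
suff /asboolP[u [z [pE uC z0]]] : toric_val p \in S.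
  by exists u, z; split=> //; apply: val_inj.
have /asboolP := toric_valP p; apply.
  split=> [|c f g|f g].
  - apply/asboolP; exists 0, 1; rewrite add0r; split=> //.
      exact: ideal_gen0.
    exact: supp_weight1.
  - move=> /asboolP[u [y [-> uC y0]]] /asboolP[v [z [-> vC z0]]].
    apply/asboolP; exists (c *: u + v), (c *: y + z); split.
    + by rewrite addrACA -scalerDr.
    + by rewrite -mulr_algl; apply: ideal_gen_linear.
    + exact: supp_weight_linear.
  - move=> /asboolP[u [y [-> uC y0]]] /asboolP[v [z [-> vC z0]]].
    apply/asboolP; exists (z * u + (u + y) * v), (y * z); split.
    (* (u + y)(v + z) = (zu + (u + y)v) + yz *)
    + by rewrite -[_ * _ in LHS]/(toric_val ((u + y) * (v + z)));
        congr toric_val; ring.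
    + by apply: ideal_gen_linear => //; apply: ideal_genM.
    + by apply: supp_weightM y0 z0 => _ _ /eqP-> /eqP->.
move=> _ /imageP[F FD ->]; apply/asboolP.
pose g := toric_gen K (exist _ F FD).
have [FC | nFC] := boolP (F \subset C).
  exists g, 0; rewrite addr0; split=> //; last exact: supp_weight0.
  exact: mem_cover_ideal_gen.
exists 0, g; rewrite add0r; split=> //; first exact: ideal_gen0.
apply: supp_weight_sub (face_monomial_weight C F) => _ /eqP->.
move: nFC (face_outside_cover hC FD); rewrite -setD_eq0 -cards_eq0.
by rewrite /=; lia.
Qed.

(** Modulo [P_C], a product is congruent to the product of the weight-zero parts
    of its factors; if it lies in [P_C], this product vanishes, hence so does one
    of the weight-zero parts, since polynomials over a field form a domain. *)
Lemma cover_ideal_prime : is_prime_ideal (cover_ideal K D C).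
Proof.
have decomp_mem p u z : p = u + z -> u \in cover_ideal K D C -> z = 0 ->
  p \in cover_ideal K D C by move=> -> uC ->; rewrite addr0.
split; first split.
- exact: ideal_gen0.
- apply/negP => /(@weight0_cover_ideal 1 (supp_weight1 _ _))/eqP.
  by rewrite oner_eq0.
- by move=> a u v; apply: ideal_gen_linear.
- move=> p q pqC.
  have [u [y [pE uC y0]]] := toric_decomposition p.
  have [v [z [qE vC z0]]] := toric_decomposition q.
  have yzC : y * z \in cover_ideal K D C.
    have -> : y * z = - z * u + (- (u + y) * v + p * q) by rewrite pE qE; ring.
    by do 2?apply: ideal_gen_linear.
  have yz0 : toric_val (y * z) \in wt (pred1 0).
    by apply: supp_weightM y0 z0 => _ _ /eqP-> /eqP->.
  have /eqP : toric_val y * toric_val z = 0.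
    by rewrite -[LHS]/(toric_val (y * z)) (weight0_cover_ideal yz0 yzC).
  rewrite mulf_eq0 => /orP[] /eqP yz_eq0; apply/orP; [left | right].
    by apply: decomp_mem pE uC _; apply: val_inj.
  by apply: decomp_mem qE vC _; apply: val_inj.
Qed.

(** If [F] is not inside [C], the generator [x_F t] is nonzero of weight at
    most 0, whereas [P_C] lives in positive weights. *)
Lemma cover_ideal_gen_sub (F : {F | F \in faces D}) :
  toric_gen K F \in cover_ideal K D C -> val F \subset C.
Proof.
move=> /cover_ideal_weight gpos; rewrite -setD_eq0 -cards_eq0 -leqn0 leqNgt.
apply/negP => FC.
have /eqP : toric_val (toric_gen K F) = 0.
  apply: supp_weight_disjoint (face_monomial_weight C (val F)) gpos => _ /eqP->.
  by lia.
exact/negP/face_monomial_neq0.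
Qed.

End Cover.

(** * Minimality *)

(** Some edge is covered by [i] only, since [C] without [i] is not a cover;
    [j] is the other end of this edge. *)
Lemma minimal_vertex_cover_edge C (i : 'I_n) :
    minimal_vertex_cover (skeleton_edges D) C -> i \in C ->
  exists2 j, j \notin C & [set i; j] \in faces D.
Proof.
move=> /minsetP[hC Cmin] iC.
have /forall_inPn[e eE] : ~~ vertex_cover (skeleton_edges D) (C :\ i).
  apply/negP => /Cmin/(_ (subD1set _ _))/setP/(_ i).
  by rewrite !inE eqxx iC.
rewrite negbK setIDAC setD_eq0 => Ce.
have [eD e2] : e \in faces D /\ #|e| == 2%N.
  by move: eE; rewrite inE => /andP.
have ie : i \in e.
  have /forall_inP/(_ e eE)/set0Pn[x xCe] := hC.
  by have := subsetP Ce x xCe; rewrite inE => /eqP <-; case/setIP: xCe.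
have /cards1P[j ej] : #|e :\ i| == 1%N.
  by move: e2; rewrite (cardsD1 i) ie add1n eqSS.
have /setD1P[ji je] : j \in e :\ i by rewrite ej set11.
exists j; last by rewrite -ej setD1K.
apply/negP => jC; have := subsetP Ce j; rewrite !inE jC je => /(_ isT).
by rewrite (negPf ji).
Qed.

(** Both sides are [x_F x_j t^2]; moving [i] from the first factor to the second
    trades the face [F] for a smaller one. *)
Lemma face_monomial_exchange F (i j : 'I_n) : i \in F -> i != j ->
  face_monomial K F * face_monomial K [set j] =
  face_monomial K [set i; j] * face_monomial K (F :\ i).
Proof.
move=> iF ij; rewrite /face_monomial (big_setD1 i iF) /= !big_set1.
rewrite big_setU1 ?inE //= big_set1; ring.
Qed.

(** Induction on the size of the face [F], by the exchange identity: its right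
    side is in [Q] by induction, and [x_j t] is not in [Q], not even in [P_C]. *)
Lemma minimal_cover_ideal_sub C (Q : {pred toric_ring K D}) :
    minimal_vertex_cover (skeleton_edges D) C -> is_prime_ideal Q ->
    toric_t K D \in Q -> {subset Q <= cover_ideal K D C} ->
  {subset cover_ideal K D C <= Q}.
Proof.
move=> Cmin [[Q0 _ QL] Qprime] Qt QC.
have hC : vertex_cover (skeleton_edges D) C by apply: minsetp Cmin.
apply: cover_ideal_sub => // -[F FD] /=.
have [k] := ubnP #|F|; elim: k => // k IHk in F FD *.
have [F0 | [i iF] ltFk FC] := set_0Vmem F.
  move=> _ _; suff <- : toric_t K D = toric_gen K (exist _ F FD) by [].
  by apply: val_inj; rewrite /= F0.
have [j jC ijD] := minimal_vertex_cover_edge Cmin (subsetP FC i iF).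
have ij : i != j by apply: contraNneq jC => <-; apply: (subsetP FC).
have FiD : F :\ i \in faces D := face_sub FD (subD1set F i).
have Fi_Q : toric_gen K (exist _ (F :\ i) FiD) \in Q.
  apply: IHk; last exact: subset_trans (subD1set _ _) FC.
  by move: ltFk; rewrite (cardsD1 i F) iF.
pose xj := toric_gen K (exist _ [set j] (face1 D j)).
pose xij := toric_gen K (exist _ [set i; j] ijD).
have : toric_gen K (exist _ F FD) * xj \in Q.
  have -> : toric_gen K (exist _ F FD) * xj =
      xij * toric_gen K (exist _ (F :\ i) FiD) + 0.
    by rewrite addr0; apply: val_inj; apply: face_monomial_exchange.
  exact: QL.
case/Qprime/orP => // /QC/(cover_ideal_gen_sub hC) /=.
by rewrite sub1set (negPf jC).
Qed.

End CoverIdealTheory.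

Theorem proposition1p4 (K : fieldType) (n : nat) (D : simplicial_complex n)
    (C : {set 'I_n}) (hC : vertex_cover (skeleton_edges D) C) :
  minimal_prime_over (ideal_gen [:: toric_t K D]) (cover_ideal K D C) <->
  minimal_vertex_cover (skeleton_edges D) C.
Proof.
have t_sub C' : {subset ideal_gen [:: toric_t K D] <= cover_ideal K D C'}.
  apply: ideal_gen_sub; first exact: ideal_gen0.
    by move=> a u v; apply: ideal_gen_linear.
  by move=> p; rewrite inE => /eqP->; apply: toric_t_cover.
split=> [[_ _ PCmin] | Cmin].
  apply/minsetP; split=> // C' hC' C'C.
  have PC'E : cover_ideal K D C' =i cover_ideal K D C.
    apply: PCmin (cover_ideal_prime K hC') (t_sub C') _.
    apply: cover_ideal_sub; first exact: ideal_gen0.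
      by move=> a u v; apply: ideal_gen_linear.
    by move=> F FC'; apply: mem_cover_ideal_gen; apply: subset_trans C'C.
  apply/eqP; rewrite eqEsubset C'C; apply/subsetP => i iC; rewrite -sub1set.
  apply: (@cover_ideal_gen_sub K _ _ _ hC' (exist _ [set i] (face1 D i))).
  by rewrite PC'E mem_cover_ideal_gen //= sub1set.
split=> [||Q Qprime tQ QC p]; [exact: cover_ideal_prime | exact: t_sub |].
have Qt : toric_t K D \in Q by apply: tQ; apply: mem_ideal_gen; apply: mem_head.
by apply/idP/idP => [/QC // | ]; apply: minimal_cover_ideal_sub p.
Qed.
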